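(* Let $\phi:[0,1]\to[0,1]$ be a nondecreasing function (score-generating function), let $n,m\ge 2$ and $\alpha\in(0,1)$. Let $1\le n''<n$, $1\le m''<m$, and set $n'=n-n''$, $m'=m-m''$. Let $\mathbf X_1,\dots,\mathbf X_n$ be i.i.d. with distribution $G$ and $\mathbf Y_1,\dots,\mathbf Y_m$ be i.i.d. with distribution $H$ on the measurable space $\mathcal Z\subset\mathbb R^d$, the two samples being independent. Let $\mathcal S_0$ be a class of scoring functions such that, for every $s\in\mathcal S_0$, the distributions of $s(\mathbf X_1)$ and $s(\mathbf Y_1)$ are continuous. Let $\widehat s\in\mathcal S_0$ be the scoring function learned from the first subsamples $\mathbf X_1,\dots,\mathbf X_{n'}$, $\mathbf Y_1,\dots,\mathbf Y_{m'}$, and let $\Phi^\phi_\alpha(\mathscr D_{n'',m''}(\widehat s))$ be the ranking-based two-sample linear rank test computed from the scores of the remaining observations (both defined in the context). Then, under the null hypothesis $\mathcal H_0: G=H$, the type-I error of the test is at most $\alpha$: $$\mathbb P_{\mathcal H_0}\left\{\Phi^\phi_\alpha\left(\mathscr D_{n'',m''}(\widehat s)\right)=1\right\}\le\alpha .$$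
   Context: A scoring function is a measurable map $s:\mathcal Z\to(-\infty,+\infty]$. Learning step: with $N'=n'+m'$, for a scoring function $s$ let $$\widehat W^\phi_{n',m'}(s)=\sum_{i=1}^{n'}\phi\left(\frac{\mathrm{Rank}'(s(\mathbf X_i))}{N'+1}\right),\qquad \mathrm{Rank}'(t)=\sum_{i=1}^{n'}\mathbb I\{s(\mathbf X_i)\le t\}+\sum_{j=1}^{m'}\mathbb I\{s(\mathbf Y_j)\le t\}.$$ The scoring function $\widehat s$ is a solution of $\max_{s\in\mathcal S_0}\widehat W^\phi_{n',m'}(s)$. It is assumed to exist and to be chosen as a measurable function of the subsamples $\mathbf X_1,\dots,\mathbf X_{n'},\mathbf Y_1,\dots,\mathbf Y_{m'}$ only (so that $\widehat s(z)$ is jointly measurable in these data and in $z$). Null quantile: for integers $a,b\ge1$ and univariate samples $X_1,\dots,X_a,Y_1,\dots,Y_b$ let $$\widehat W^\phi_{a,b}=\sum_{i=1}^a\phi\left(\frac{\mathrm{Rank}(X_i)}{a+b+1}\right),$$ where $\mathrm{Rank}(X_i)$ is the rank of $X_i$ in the pooled sample, i.e. the number of pooled observations $\le X_i$. When all $a+b$ observations are i.i.d. from a continuous distribution on $\mathbb R$ (univariate null hypothesis), the law of $\widehat W^\phi_{a,b}$ does not depend on that distribution; probabilities under it are denoted $\mathbb P_{\mathcal H_0}$ here. Define $$q^\phi_{a,b}(\alpha)=\inf\left\{t\ge0:\ \mathbb P_{\mathcal H_0}\left\{\tfrac1a\widehat W^\phi_{a,b}-\int_0^1\phi(u)\,du\le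 t\right\}\ge1-\alpha\right\}.$$ Test step: with $\mathscr D_{n'',m''}(\widehat s)=\{\widehat s(\mathbf X_{1+n'}),\dots,\widehat s(\mathbf X_n)\}\cup\{\widehat s(\mathbf Y_{1+m'}),\dots,\widehat s(\mathbf Y_m)\}$, let $$\widehat W^\phi_{n'',m''}(\widehat s)=\sum_{i=1+n'}^n\phi\left(\frac{\mathrm{Rank}''(\widehat s(\mathbf X_i))}{n''+m''+1}\right),\quad \mathrm{Rank}''(t)=\sum_{i=1+n'}^n\mathbb I\{\widehat s(\mathbf X_i)\le t\}+\sum_{j=1+m'}^m\mathbb I\{\widehat s(\mathbf Y_j)\le t\},$$ and $$\Phi^\phi_\alpha(\mathscr D_{n'',m''}(\widehat s))=\mathbb I\left\{\frac1{n''}\widehat W^\phi_{n'',m''}(\widehat s)>\int_0^1\phi(u)\,du+q^\phi_{n'',m''}(\alpha)\right\}.$$ The value 1 means that $\mathcal H_0$ is rejected. *)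

(* Defs.v *)
From HB Require Import structures.
From mathcomp Require Import all_boot all_order all_algebra.
From mathcomp Require Import all_classical all_reals all_analysis.
From mathcomp Require Import measurable_realfun.

Set Implicit Arguments.
Unset Strict Implicit.
Unset Printing Implicit Defensive.

Import Order.TTheory GRing.Theory Num.Theory.
Import numFieldNormedType.Exports.

Local Open Scope classical_set_scope.
Local Open Scope ring_scope.

(* [Z] is a subset of R^k with the trace of the Borel sigma-algebra, [iota]
   being the inclusion map. The sigma-algebra of [k.-tuple R] is the product
   one, i.e. the Borel sigma-algebra of R^k. *)
Definition euclidean_subspace (R : realType) (k : nat) dZ
    (Z : measurableType dZ) (iota : Z -> k.-tuple R) : Prop :=
  injective iota /\
  forall A : set Z, measurable A <->
    exists2 B : set (k.-tuple R), measurable B & A = iota @^-1` B.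

Definition mutually_independent d (Omega : measurableType d) (R : realType)
    (P : probability Omega R) dT (T : measurableType dT) (I : finType)
    (X : I -> {RV P >-> T}) : Prop :=
  forall (J : {set I}) (A : I -> set T),
    (forall i, i \in J -> measurable (A i)) ->
    P [set w | forall i, i \in J -> A i (X i w)]
      = (\prod_(i in J) P (X i @^-1` A i))%E.

(* Measures are functions on all subsets, unconstrained outside the
   sigma-algebra, so laws are only compared on measurable sets. *)
Definition iid d (Omega : measurableType d) (R : realType)
    (P : probability Omega R) dT (T : measurableType dT) (I : finType)
    (X : I -> {RV P >-> T}) (F : probability T R) : Prop :=
  mutually_independent X /\
  forall i (A : set T), measurable A -> distribution P (X i) A = F A.

Definition sample d (Omega : measurableType d) (R : realType)
    (P : probability Omega R) dT (T : measurableType dT) (n : nat)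
    (X : 'I_n -> {RV P >-> T}) (w : Omega) : n.-tuple T :=
  [tuple X i w | i < n].

Definition independent_samples d (Omega : measurableType d) (R : realType)
    (P : probability Omega R) dT (T : measurableType dT) (n m : nat)
    (X : 'I_n -> {RV P >-> T}) (Y : 'I_m -> {RV P >-> T}) : Prop :=
  forall (A : set (n.-tuple T)) (B : set (m.-tuple T)),
    measurable A -> measurable B ->
    P (sample X @^-1` A `&` sample Y @^-1` B)
      = (P (sample X @^-1` A) * P (sample Y @^-1` B))%E.

(* No point mass. On [\bar R] this excludes an atom at [+oo] as well. *)
Definition continuous_law (R : realType) (T : Type) (mu : set T -> \bar R) :
    Prop :=
  forall t : T, mu [set t] = 0%E.

Definition first_part (T : Type) (n k : nat) (le_kn : (k <= n)%N)
    (x : n.-tuple T) : (n - k).-tuple T :=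
  [tuple tnth x (cast_ord (subnK le_kn) (lshift k i)) | i < n - k].

Definition last_part (T : Type) (n k : nat) (le_kn : (k <= n)%N)
    (x : n.-tuple T) : k.-tuple T :=
  [tuple tnth x (cast_ord (subnK le_kn) (rshift (n - k) i)) | i < k].

Definition score_generating (R : realType) (phi : R -> R) : Prop :=
  {in `[0, 1]%R, forall u, 0 <= phi u <= 1} /\
  {in `[0, 1]%R &, {homo phi : u v / u <= v}}.

Definition rank disp (T : orderType disp) (a b : nat)
    (x : a.-tuple T) (y : b.-tuple T) (t : T) : nat :=
  (\sum_(i < a) (tnth x i <= t)%O + \sum_(j < b) (tnth y j <= t)%O)%N.

Definition rank_stat (R : realType) (phi : R -> R) disp (T : orderType disp)
    (a b : nat) (x : a.-tuple T) (y : b.-tuple T) : R :=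
  \sum_(i < a) phi ((rank x y (tnth x i))%:R / (a + b + 1)%:R).

Definition phi_mean (R : realType) (phi : R -> R) : R :=
  \int[lebesgue_measure]_(u in `[0%R, 1%R]) phi u.

(* [a + b] real observations, i.i.d. from some continuous distribution, on some
   probability space. The law of the rank statistic is the same for all such
   models, so no particular one is singled out. *)
Record null_model (R : realType) (a b : nat) := NullModel {
  null_display : measure_display;
  null_space : measurableType null_display;
  null_prob : probability null_space R;
  null_obs : 'I_a + 'I_b -> {RV null_prob >-> R};
  null_law : probability R R;
  null_law_continuous : continuous_law null_law;
  null_obs_iid : iid null_obs null_law }.

Definition null_rank_stat (R : realType) (a b : nat) (M : null_model R a b)
    (phi : R -> R) (w : null_space M) : R :=
  rank_stat phi (sample (fun i : 'I_a => null_obs M (inl i)) w)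
                (sample (fun j : 'I_b => null_obs M (inr j)) w).

Definition null_quantile (R : realType) (a b : nat) (M : null_model R a b)
    (phi : R -> R) (alpha : R) : R :=
  inf [set t : R | 0 <= t /\
    ((1 - alpha)%:E <= null_prob M
       [set w | (null_rank_stat phi w / a%:R - phi_mean phi <= t)%R])%E].

Definition scoring_function (R : realType) dZ (Z : measurableType dZ)
    (s : Z -> \bar R) : Prop :=
  measurable_fun [set: Z] s /\ forall z, s z != -oo%E.

Definition score_rank_stat (R : realType) (phi : R -> R) (Z : Type)
    (s : Z -> \bar R) (a b : nat) (x : a.-tuple Z) (y : b.-tuple Z) : R :=
  rank_stat phi (map_tuple s x) (map_tuple s y).

Definition learning_rule (R : realType) (phi : R -> R) dZ
    (Z : measurableType dZ) (S0 : set (Z -> \bar R)) (a b : nat)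
    (learn : a.-tuple Z * b.-tuple Z -> Z -> \bar R) : Prop :=
  [/\ forall D, S0 (learn D),
      forall D (s : Z -> \bar R), S0 s ->
        score_rank_stat phi s D.1 D.2 <=
        score_rank_stat phi (learn D) D.1 D.2
    & measurable_fun [set: (a.-tuple Z * b.-tuple Z) * Z]
        (fun p => learn p.1 p.2)].

Definition rank_test (R : realType) (phi : R -> R) (q : R) disp
    (T : orderType disp) (a b : nat) (x : a.-tuple T) (y : b.-tuple T) : nat :=
  (phi_mean phi + q < rank_stat phi x y / a%:R)%R.

(* The last [n2] and [m2] observations form the test samples. *)
Definition two_stage_test (R : realType) (phi : R -> R) (q : R) dZ
    (Z : measurableType dZ) (n m n2 m2 : nat)
    (len : (n2 <= n)%N) (lem : (m2 <= m)%N)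
    (learn : (n - n2).-tuple Z * (m - m2).-tuple Z -> Z -> \bar R)
    (x : n.-tuple Z) (y : m.-tuple Z) : nat :=
  let s := learn (first_part len x, first_part lem y) in
  rank_test phi q (map_tuple s (last_part len x))
                  (map_tuple s (last_part lem y)).

(* Main.v *)
Require Import Defs.
From HB Require Import structures.
From mathcomp Require Import all_boot all_order all_algebra fingroup perm.
From mathcomp Require Import all_classical all_reals all_analysis.
From mathcomp Require Import measurable_realfun.

(** The rank statistic sees the test scores only through their ranks, and the
    ranks of i.i.d. scores without ties are a uniformly distributed permutation,
    whatever the law of the scores. The scoring function is random here, but it
    is built from the training half, which is independent of the test half: once
    the training data are fixed, it is one fixed member of [S0], the test scores
    are i.i.d. from a continuous law, and their ranks are uniform. The rank
    statistic therefore has under the null hypothesis the very law that defines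
    the critical value, and the level is that of the univariate test.

    The uniformity of the ranks ([rank_event_prob]) is proved without
    conditional laws, from two properties of the joint sample.
    - Permuting the test observations changes neither the joint law of the
      sample nor the training data, so all rankings have the same probability
      ([rank_event_exchangeable], [rankings_equiprobable]).
    - Ties have probability zero ([ties_negligible]). This is where the
      independence of training and test data enters: a tie between observations
      i and j forces observation j into a level set of the learned scoring
      function, a set determined by the other observations and null by the
      continuity assumption; Fubini applies ([iid_null_sections]).
    Hence the |I|! rankings share the total mass 1 equally.

    [rank_event_prob] is used twice: for the learned scores, and for the
    univariate null model, which is the case of an empty training sample and the
    identity as scoring function. Both give the same count of permutations, so
    it remains to bound that count by alpha for the null model
    ([null_rejection_frequency]); this holds because the infimum defining the
    critical value is attained ([quantile_exceedance]). *)

Set Implicit Arguments.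
Unset Strict Implicit.
Unset Printing Implicit Defensive.

Import Order.TTheory GRing.Theory Num.Theory.
Import numFieldNormedType.Exports.

Local Open Scope classical_set_scope.
Local Open Scope ring_scope.

(** * Laws of i.i.d. samples *)

Definition box (T : Type) n (A : 'I_n -> set T) : set (n.-tuple T) :=
  [set t | forall i, A i (tnth t i)].

Lemma measurable_box d (T : measurableType d) n (A : 'I_n -> set T) :
  (forall i, measurable (A i)) -> measurable (box A).
Proof.
move=> mA.
have -> : box A = \bigcap_(i in [set: 'I_n]) ((fun t => tnth t i) @^-1` A i).
  by apply/seteqP; split=> t /= h i; [move=> _; exact: h|exact: (h i I)].
apply: fin_bigcap_measurable => // i _.
by rewrite -[X in measurable X]setTI; apply: measurable_tnth.
Qed.

(** Boxes are stable under intersection and generate the product sigma-algebra,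
    so Dynkin's uniqueness theorem applies. *)
Lemma measure_eq_on_boxes d (T : measurableType d) (R : realType) n
    (m1 m2 : {measure set (n.-tuple T) -> \bar R}) :
  (m1 setT < +oo)%E ->
  (forall A : 'I_n -> set T, (forall i, measurable (A i)) ->
     m1 (box A) = m2 (box A)) ->
  forall C, measurable C -> m1 C = m2 C.
Proof.
move=> m1_fin m12 C mC.
pose B := [set D | exists2 A : 'I_n -> set T,
  (forall i, measurable (A i)) & D = box A].
have BT : B setT.
  by exists (fun=> setT) => //; apply/seteqP; split.
apply: (measure_unique B (fun=> setT)) => //.
- apply/seteqP; split; last first.
    apply: smallest_sub; first exact: sigma_algebra_measurable.
    by move=> _ [A mA ->]; exact: measurable_box.
  apply: smallest_sub; first exact: smallest_sigma_algebra.
  move=> D; rewrite -bigcup_seq => -[i _] [A mA <-].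
  apply: sub_sigma_algebra; exists (fun k => if k == i then A else setT).
    by move=> k; case: ifP.
  apply/seteqP; split=> t /=.
    by move=> [_ At] k; case: eqVneq => // ->.
  by move=> /(_ i); rewrite eqxx.
- move=> _ _ [A mA ->] [A' mA' ->]; exists (fun i => A i `&` A' i).
    by move=> i; exact: measurableI.
  apply/seteqP; split=> t /= => [[h h'] i|h].
    by split; [exact: h|exact: h'].
  by split=> i; have [] := h i.
- by apply/seteqP; split=> // t _; exists 0%N.
- by move=> _ [A mA ->]; exact: m12.
Qed.

Section sample_measurable.
Context d (Omega : measurableType d) (R : realType) (P : probability Omega R)
  dT (T : measurableType dT) (n : nat) (X : 'I_n -> {RV P >-> T}).

Lemma measurable_sample : measurable_fun setT (sample X).
Proof.
apply/measurable_fun_tnthP => i.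
rewrite (_ : _ \o _ = X i); first exact: measurable_funPT.
by apply/funext => w /=; rewrite tnth_mktuple.
Qed.

HB.instance Definition _ := isMeasurableFun.Build _ _ _ _ (sample X)
  measurable_sample.

End sample_measurable.

Lemma sample_preimage_box d (Omega : measurableType d) (R : realType)
    (P : probability Omega R) dT (T : measurableType dT) n
    (X : 'I_n -> {RV P >-> T}) (A : 'I_n -> set T) :
  sample X @^-1` box A = [set w | forall i, A i (X i w)].
Proof.
by apply/seteqP; split=> w /= h i; move: (h i); rewrite tnth_mktuple.
Qed.

Lemma iid_box d (Omega : measurableType d) (R : realType)
    (P : probability Omega R) dT (T : measurableType dT) (I : finType)
    (V : I -> {RV P >-> T}) (F : probability T R) (A : I -> set T) :
  iid V F -> (forall i, measurable (A i)) ->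
  P [set w | forall i, A i (V i w)] = (\prod_i F (A i))%E.
Proof.
move=> [Vind VF] mA.
have /= := Vind [set: I]%SET A (fun i _ => mA i).
rewrite (_ : [set w | _] = [set w | forall i, A i (V i w)]); last first.
  by apply/seteqP; split=> w /= h i; [apply: h|move=> _; apply: h].
move=> ->; apply: eq_big => [i|i _]; first by rewrite inE.
exact: VF.
Qed.

(** The samples may live on different probability spaces. In particular, an
    i.i.d. sample and any permutation of it have the same law. *)
Lemma iid_sample_law d (Omega : measurableType d)
    d' (Omega' : measurableType d') (R : realType)
    (P : probability Omega R) (P' : probability Omega' R)
    dT (T : measurableType dT) n (F : probability T R)
    (V : 'I_n -> {RV P >-> T}) (V' : 'I_n -> {RV P' >-> T}) :
  iid V F -> iid V' F -> forall C, measurable C ->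
  P (sample V @^-1` C) = P' (sample V' @^-1` C).
Proof.
move=> VF VF' C mC.
apply: (@measure_eq_on_boxes _ _ R n (distribution P (sample V))
   (distribution P' (sample V'))) => //.
  by rewrite [X in (X < _)%E]probability_setT ltry.
move=> A mA.
change (P (sample V @^-1` box A) = P' (sample V' @^-1` box A)).
by rewrite !sample_preimage_box !(iid_box (F := F)).
Qed.

(** Injectivity matters: repeating an observation destroys independence. *)
Lemma iid_reindex d (Omega : measurableType d) (R : realType)
    (P : probability Omega R) dT (T : measurableType dT) (I J : finType)
    (V : I -> {RV P >-> T}) (F : probability T R) (g : J -> I) :
  injective g -> iid V F -> iid (V \o g) F.
Proof.
move=> g_inj [Vind VF]; split=> [K A mA|j A mA]; last exact: VF.
(* A transported along g; the equation g j = i spares an inverse of g. *)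
pose B i := [set z | forall j, j \in K -> g j = i -> A j z].
have BE j : j \in K -> B (g j) = A j.
  move=> jK; apply/seteqP; split=> z; first by move=> /(_ j jK erefl).
  by move=> Az k kK /g_inj ->.
have /= := Vind (g @: K)%SET B.
rewrite (_ : [set w | _] =
    [set w | forall j, j \in K -> A j ((V \o g) j w)]); last first.
  apply/seteqP; split=> w /= h => [j jK|i /imsetP[j jK ->]].
    by rewrite -BE //; apply: h; exact: imset_f.
  by rewrite BE //; exact: h.
move=> ->; last by move=> i /imsetP[j jK ->]; rewrite BE //; exact: mA.
rewrite big_imset /=; last by move=> ? ? _ _; exact: g_inj.
by apply: eq_bigr => j jK; rewrite BE.
Qed.

(** Intersecting the constraints that a box puts on each observation [f k] turns
    it into a product event over the indices other than [j], for which mutual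
    independence applies; boxes determine the law. *)
Lemma iid_independent_others d (Omega : measurableType d) (R : realType)
    (P : probability Omega R) dT (T : measurableType dT) (I : finType)
    (V : I -> {RV P >-> T}) (F : probability T R) n (f : 'I_n -> I) (j : I) :
  iid V F -> (forall k, f k != j) ->
  forall (A : set (n.-tuple T)) (B : set T), measurable A -> measurable B ->
  P (sample (V \o f) @^-1` A `&` V j @^-1` B)
    = (P (sample (V \o f) @^-1` A) * F B)%E.
Proof.
move=> VF fj A B mA mB.
have mVB : measurable (V j @^-1` B) by exact: measurable_funPTI.
have FB_fin : F B \is a fin_num by exact: fin_num_measure.
have FB_ge0 : 0 <= fine (F B) by exact: fine_ge0.
(* For fixed B both sides are finite measures in A, comparable on boxes. *)
pose m1 := pushforward (mrestr P mVB) (sample (V \o f)).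
pose m2 := mscale (NngNum FB_ge0) (distribution P (sample (V \o f))).
suff : m1 A = m2 A by rewrite /m1 /m2 /mscale /= fineK // muleC.
apply: measure_eq_on_boxes => //.
  change (P (setT `&` V j @^-1` B) < +oo)%E.
  by rewrite setTI ltey_eq fin_num_measure.
move=> D mD.
change (P (sample (V \o f) @^-1` box D `&` V j @^-1` B) =
  ((fine (F B))%:E * P (sample (V \o f) @^-1` box D))%E).
rewrite sample_preimage_box fineK //.
pose E i := [set z | forall k, f k = i -> D k z].
have mE i : measurable (E i).
  have -> : E i = \bigcap_(k in [set k | f k = i]) D k by [].
  by apply: fin_bigcap_measurable => //.
have Ej : E j = setT.
  by apply/seteqP; split=> // z _ k /eqP; rewrite (negbTE (fj k)).
pose E' i := if i == j then B else E i.
have -> : [set w | forall k, D k ((V \o f) k w)] =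
    [set w | forall i, E i (V i w)].
  apply/seteqP; split=> w /= => [h i k <-|h k]; first exact: h.
  exact: (h (f k) k erefl).
have -> : [set w | forall i, E i (V i w)] `&` V j @^-1` B =
          [set w | forall i, E' i (V i w)].
  apply/seteqP; split=> w /=.
    by move=> [h Bw] i; rewrite /E'; case: eqVneq => [->|].
  move=> h; split=> [i|]; last by have := h j; rewrite /E' eqxx.
  by have := h i; rewrite /E'; case: eqVneq => // ->; rewrite Ej.
rewrite !(iid_box (F := F)) //; last by move=> i; rewrite /E'; case: ifP.
rewrite (bigD1 j) //= [in RHS](bigD1 j) //= Ej probability_setT mul1e.
rewrite /E' eqxx; congr (_ * _)%E.
by apply: eq_bigr => i /negbTE ->.
Qed.

(** By independence the pair (other observations, observation [j]) has a product
    law, for which a set with null sections is null by Fubini. *)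
Lemma iid_null_sections d (Omega : measurableType d) (R : realType)
    (P : probability Omega R) dT (T : measurableType dT) (I : finType)
    (V : I -> {RV P >-> T}) (F : probability T R) n (f : 'I_n -> I) (j : I)
    (C : set (n.-tuple T * T)) :
  iid V F -> (forall k, f k != j) -> measurable C ->
  (forall u, F (xsection C u) = 0%E) ->
  P [set w | C (sample (V \o f) w, V j w)] = 0%E.
Proof.
move=> VF fj mC C0.
pose h w := (sample (V \o f) w, V j w).
have mh : measurable_fun setT h.
  apply: measurable_fun_pair; last exact: measurable_funPT.
  exact: measurable_sample.
pose hRV : {RV P >-> (n.-tuple T * T)%type} :=
  HB.pack_for {RV P >-> (n.-tuple T * T)%type} h
  (isMeasurableFun.Build _ _ _ _ h mh).
change (P (hRV @^-1` C) = 0%E).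
have <- : (distribution P (sample (V \o f)) \x F)%E C = P (hRV @^-1` C).
  apply: (@product_measure_unique _ _ _ _ R
    (distribution P (sample (V \o f))) F (distribution P hRV)) => // A B mA mB.
  exact: (iid_independent_others VF fj).
rewrite /product_measure1 integral0_eq // => u _.
exact: C0.
Qed.

Definition pooled (A B C : Type) (x : A -> C) (y : B -> C) (k : A + B) : C :=
  match k with inl i => x i | inr j => y j end.

(** Under the null hypothesis the two samples form a single i.i.d. family. *)
Lemma iid_pooled d (Omega : measurableType d) (R : realType)
    (P : probability Omega R) dT (T : measurableType dT) n m
    (X : 'I_n -> {RV P >-> T}) (Y : 'I_m -> {RV P >-> T})
    (F : probability T R) :
  iid X F -> iid Y F -> independent_samples X Y -> iid (pooled X Y) F.
Proof.
move=> [Xind XF] [Yind YF] XY; split; last by case.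
move=> J A mA.
pose A1 i := if inl i \in J then A (inl i) else setT.
pose A2 j := if inr j \in J then A (inr j) else setT.
have mA1 i : measurable (A1 i) by rewrite /A1; case: ifP => // /mA.
have mA2 j : measurable (A2 j) by rewrite /A2; case: ifP => // /mA.
have -> : [set w | forall i, i \in J -> A i (pooled X Y i w)] =
    sample X @^-1` box A1 `&` sample Y @^-1` box A2.
  rewrite !sample_preimage_box; apply/seteqP; split=> w /=.
    move=> h; split=> i; [rewrite /A1|rewrite /A2]; case: ifP => // iJ.
      exact: (h _ iJ).
    exact: (h _ iJ).
  move=> [h1 h2] [i|j] kJ /=.
    by have := h1 i; rewrite /A1 kJ.
  by have := h2 j; rewrite /A2 kJ.
rewrite XY; [|exact: measurable_box|exact: measurable_box].
rewrite !sample_preimage_box.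
rewrite (iid_box (F := F)) // (iid_box (F := F)) //.
rewrite big_sumType /=; congr (_ * _)%E.
  rewrite [RHS]big_mkcond /=; apply: eq_bigr => i _; rewrite /A1.
  case: ifP => iJ; last exact: probability_setT.
  by rewrite -(XF i) //; exact: mA.
rewrite [RHS]big_mkcond /=; apply: eq_bigr => j _; rewrite /A2.
case: ifP => jJ; last exact: probability_setT.
by rewrite -(YF j) //; exact: mA.
Qed.

Lemma measure_disjoint_union d (S : measurableType d) (R : realType)
    (mu : {measure set S -> \bar R}) (I : finType) (D : pred I)
    (A : I -> set S) :
  (forall i, measurable (A i)) -> (forall i j x, A i x -> A j x -> i = j) ->
  mu (\bigcup_(i in [set` D]) A i) = (\sum_(i | D i) mu (A i))%E.
Proof.
move=> mA A_disj; rewrite measure_fin_bigcup //.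
  rewrite -(@bigfs _ _ _ _ (index_enum I)) ?index_enum_uniq // => i.
  by rewrite mem_index_enum.
by move=> i j _ _ [x [Ai Aj]]; exact: A_disj Ai Aj.
Qed.

(** * Ranks and permutations *)

Definition rank_in disp (T : orderType disp) (I : finType) (z : I -> T) (i : I)
    : nat := (\sum_(k : I) (z k <= z i)%O)%N.

(** Ranks count from 1, the fixed enumeration of [I] from 0. *)
Definition perm_rank (I : finType) (sigma : {perm I}) (i : I) : nat :=
  (enum_rank (sigma i)).+1.

Lemma perm_rank_inj (I : finType) : injective (@perm_rank I).
Proof.
move=> s t st; apply/permP => i; apply: enum_rank_inj; apply: val_inj.
by have [] := congr1 (fun r => r i) st.
Qed.

(** An entry dominates itself, and a strictly larger entry dominates strictly
    more entries; so without ties the ranks are distinct and between 1 and |I|. *)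
Lemma rank_in_perm disp (T : orderType disp) (I : finType) (z : I -> T) :
  injective z -> exists sigma : {perm I}, rank_in z = perm_rank sigma.
Proof.
move=> z_inj.
pose below i := [pred k | (z k <= z i)%O].
have rE i : rank_in z i = #|below i|.
  rewrite /rank_in -sum1_card [RHS]big_mkcond /=.
  by apply: eq_bigr => k _; rewrite inE; case: (_ <= _)%O.
have r_gt0 i : (0 < rank_in z i)%N.
  by rewrite rE; apply/card_gt0P; exists i; rewrite inE.
have r_lt i : ((rank_in z i).-1 < #|I|)%N by rewrite prednK // rE max_card.
have r_mono i j : (z i < z j)%O -> (rank_in z i < rank_in z j)%N.
  move=> ij; rewrite !rE; apply/proper_card/properP; split.
    by apply/fintype.subsetP => k; rewrite !inE => /le_trans; apply; exact: ltW.
  by exists j; rewrite !inE // -ltNge.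
pose sigma i := enum_val (Ordinal (r_lt i)).
have sigma_inj : injective sigma.
  move=> i j /enum_val_inj /(congr1 val) /= /(congr1 S).
  rewrite !prednK // => rij; apply: z_inj.
  by case: (ltgtP (z i) (z j)) => // /r_mono; rewrite rij ltnn.
exists (perm sigma_inj); apply/funext => i.
by rewrite /perm_rank permE enum_valK /= prednK.
Qed.

Lemma rank_in_reindex disp (T : orderType disp) (I : finType) (z : I -> T)
    (sigma : {perm I}) i : rank_in (z \o sigma) i = rank_in z (sigma i).
Proof. by rewrite /rank_in [RHS](reindex_inj (@perm_inj _ sigma)). Qed.

(** Ranks depend only on the finite table of comparisons between the entries,
    so any condition on them is a finite union of measurable events. *)
Lemma measurable_ranks d (S : measurableType d) (R : realType) (I : finType)
    (z : I -> S -> \bar R)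
    (F : set (I -> nat)) :
  (forall i, measurable_fun setT (z i)) ->
  measurable [set x | F (rank_in (z ^~ x))].
Proof.
move=> mz.
pose M x : {ffun I * I -> bool} := [ffun p => (z p.1 x <= z p.2 x)%E].
pose rk (m : {ffun I * I -> bool}) i := (\sum_k m (k, i))%N.
have rkM x : rank_in (z ^~ x) = rk (M x).
  by apply/funext => i; apply: eq_bigr => k _; rewrite ffunE.
have -> : [set x | F (rank_in (z ^~ x))] =
    \bigcup_(m in [set m | F (rk m)]) (M @^-1` [set m]).
  apply/seteqP; split=> x /=; first by rewrite rkM => Fx; exists (M x).
  by move=> [m Fm /= Mx]; rewrite rkM Mx.
apply: fin_bigcup_measurable => // m _.
have -> : M @^-1` [set m] = \bigcap_(p in [set: I * I])
    [set x | (z p.1 x <= z p.2 x)%E = m p].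
  apply/seteqP; split=> x /= => [<- p _ /=|h]; first by rewrite ffunE.
  by apply/ffunP => p; rewrite ffunE h.
apply: fin_bigcap_measurable => // p _.
have := measurable_fun_lee (mz p.1) (mz p.2).
move=> /(_ measurableT [set m p]) /=; rewrite setTI; exact.
Qed.

(** * Uniform ranks of learned scores *)

(** The indices [inl k] are the training observations, which determine the
    scoring function [s u], and the indices [inr i] are the observations to be
    scored. Continuity is assumed for each fixed value of the training data. *)
Section rank_law.
Context d (Omega : measurableType d) (R : realType) (P : probability Omega R)
  dT (T : measurableType dT) (l : nat) (I : finType)
  (s : l.-tuple T -> T -> \bar R)
  (ms : measurable_fun setT (fun p : l.-tuple T * T => s p.1 p.2)).

Definition scores (V : 'I_l + I -> {RV P >-> T}) (w : Omega) (i : I) : \bar R :=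
  s (sample (V \o inl) w) (V (inr i) w).

Variables (F : probability T R) (V : 'I_l + I -> {RV P >-> T}) (VF : iid V F)
  (F_cont : forall u, continuous_law (pushforward F (s u))).

Local Notation K := ('I_l + I)%type.

(** The scores as a function of all the observations, listed in one tuple: the
    sigma-algebra and the uniqueness theorem are those of tuples. *)
Definition data_scores (t : #|{: K}|.-tuple T) (i : I) : \bar R :=
  s [tuple tnth t (enum_rank (inl k : K)) | k < l]
    (tnth t (enum_rank (inr i : K))).

Lemma scoresE (V' : K -> {RV P >-> T}) w :
  scores V' w = data_scores (sample (fun k => V' (enum_val k)) w).
Proof.
apply/funext => i; rewrite /scores /data_scores; congr (s _ _).
  by apply: eq_from_tnth => k; rewrite !tnth_mktuple enum_rankK.
by rewrite !tnth_mktuple enum_rankK.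
Qed.

Lemma measurable_data_scores i : measurable_fun setT (data_scores ^~ i).
Proof.
apply: (measurableT_comp ms (g := fun t =>
  ([tuple tnth t (enum_rank (inl k : K)) | k < l],
   tnth t (enum_rank (inr i : K))))).
apply: measurable_fun_pair; last exact: measurable_tnth.
apply/measurable_fun_tnthP => k.
rewrite (_ : _ \o _ = (fun t => tnth t (enum_rank (inl k : K)))).
  exact: measurable_tnth.
by apply/funext => t /=; rewrite tnth_mktuple.
Qed.

Lemma measurable_scores i : measurable_fun setT (fun w => scores V w i).
Proof.
rewrite (_ : (fun w => _) =
    data_scores ^~ i \o sample (fun k => V (enum_val k))).
  apply: measurableT_comp; first exact: measurable_data_scores.
  exact: measurable_sample.
by apply/funext => w; rewrite scoresE.
Qed.

Lemma measurable_rank_event (E : set (I -> nat)) :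
  measurable [set w | E (rank_in (scores V w))].
Proof. exact: measurable_ranks measurable_scores. Qed.

(** Permuting the scored observations leaves the training data, hence the
    scoring function, unchanged; and it preserves the joint law. *)
Lemma rank_event_exchangeable (sigma : {perm I}) (E : set (I -> nat)) :
  P [set w | E (rank_in (scores V w \o sigma))] =
  P [set w | E (rank_in (scores V w))].
Proof.
pose g (k : K) : K := match k with inl a => inl a | inr i => inr (sigma i) end.
have g_inj : injective g by move=> [a|i] [b|j] //= [] // /perm_inj ->.
have -> : [set w | E (rank_in (scores V w \o sigma))] =
    [set w | E (rank_in (scores (V \o g) w))] by [].
have mE := measurable_ranks (z := fun i t => data_scores t i) E
  measurable_data_scores.
have VF1 := iid_reindex (@enum_val_inj _ {: K}) VF.
have VF2 := iid_reindex (@enum_val_inj _ {: K}) (iid_reindex g_inj VF).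
have := iid_sample_law VF2 VF1 mE.
by congr (P _ = P _); apply/funext => w /=; rewrite scoresE.
Qed.

(** A tie puts observation [j] in the level set, through the score of [i], of a
    scoring function determined by the training data; this set depends on the
    observations other than [j] only, and is null. *)
Lemma ties_negligible (i j : I) : i != j ->
  P.-negligible [set w | scores V w i = scores V w j].
Proof.
move=> ij; apply/negligibleP.
  by rewrite -[X in measurable X]setTI; apply: measurable_eqe => //;
    exact: measurable_scores.
(* Coordinate 0 is observation i, the others are the training data. *)
pose f (k : 'I_l.+1) : K := match unlift ord0 k with
  Some a => inl a | None => inr i end.
pose past (u : l.+1.-tuple T) := [tuple tnth u (lift ord0 k) | k < l].
have fj k : f k != inr j.
  by rewrite /f; case: unliftP => [a _|_] //; apply: contra ij => /eqP[->].
pose C := [set p : l.+1.-tuple T * T |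
  s (past p.1) (tnth p.1 ord0) = s (past p.1) p.2].
have mpast : measurable_fun setT past.
  apply/measurable_fun_tnthP => k.
  rewrite (_ : _ \o _ = (fun t => tnth t (lift ord0 k))).
    exact: measurable_tnth.
  by apply/funext => t /=; rewrite tnth_mktuple.
have mC : measurable C.
  rewrite -[C]setTI; apply: measurable_eqe => //.
    apply: (measurableT_comp ms
      (g := fun p : l.+1.-tuple T * T => (past p.1, tnth p.1 ord0))).
    apply: measurable_fun_pair; first exact: measurableT_comp.
    exact: (measurableT_comp (measurable_tnth _)).
  apply: (measurableT_comp ms
    (g := fun p : l.+1.-tuple T * T => (past p.1, p.2))).
  by apply: measurable_fun_pair => //; exact: measurableT_comp.
rewrite -[RHS](iid_null_sections VF fj mC); last first.
  move=> u; rewrite -(F_cont (past u) (s (past u) (tnth u ord0))).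
  congr (F _); apply/seteqP; split=> z; rewrite /xsection /= inE /C /=.
    by move=> ->.
  by move=> ->.
congr (P _); apply/seteqP; split=> w; rewrite /C /scores /=;
  rewrite tnth_mktuple /= /f unlift_none;
  (have -> : past (sample (V \o f) w) = sample (V \o inl) w by
    apply: eq_from_tnth => k; rewrite !tnth_mktuple /= /f liftK);
  done.
Qed.

Let ranking sigma := [set w | rank_in (scores V w) = perm_rank sigma].

Let measurable_ranking sigma : measurable (ranking sigma).
Proof. exact: (measurable_rank_event [set r | r = perm_rank sigma]). Qed.

Let ranking_disjoint sigma tau w :
  ranking sigma w -> ranking tau w -> sigma = tau.
Proof. by rewrite /ranking /= => -> /perm_rank_inj. Qed.

Lemma rankings_equiprobable sigma : P (ranking sigma) = P (ranking 1%g).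
Proof.
rewrite -(rank_event_exchangeable sigma [set r | r = perm_rank sigma]).
congr (P _); apply/seteqP; split=> w /= h; apply/funext => i; last first.
  by rewrite rank_in_reindex h /perm_rank perm1.
have := congr1 (fun r => r ((sigma^-1)%g i)) h.
by rewrite rank_in_reindex /perm_rank permKV perm1.
Qed.

Lemma rankings_exhaust : P.-negligible (~` \bigcup_sigma ranking sigma).
Proof.
pose ties (p : I * I) :=
  if p.1 == p.2 then set0 else [set w | scores V w p.1 = scores V w p.2].
have ties0 p : P.-negligible (ties p).
  rewrite /ties; case: ifPn => [_|ij]; first exact: negligible_set0.
  exact: ties_negligible.
apply: (@negligibleS _ _ _ _ (\big[setU/set0]_p ties p)); last first.
  by elim/big_ind : _ => //; [exact: negligible_set0|exact: negligibleU].
move=> w Nw; apply: contrapT => no_tie; apply: Nw.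
have inj : injective (scores V w).
  move=> i j ij; apply/eqP; apply: contrapT => /negP nij; apply: no_tie.
  rewrite -bigcup_seq; exists (i, j); first by rewrite /= mem_index_enum.
  by rewrite /ties /= (negbTE nij).
by have [sigma] := rank_in_perm inj; exists sigma.
Qed.

(** The rankings are equally likely and almost surely one of them occurs, so a
    rank event is measured by counting; neither the scoring rule nor the law of
    the data enters the count. *)
Lemma rank_event_prob (E : set (I -> nat)) :
  P [set w | E (rank_in (scores V w))] =
  (#|[pred sigma : {perm I} | `[< E (perm_rank sigma) >]]|%:R
     / #|{perm I}|%:R)%:E.
Proof.
pose D sigma := `[< E (perm_rank sigma) >].
have unionE (Q : pred {perm I}) : P (\bigcup_(sigma in [set` Q]) ranking sigma)
    = (#|Q|%:R * fine (P (ranking 1%g)))%:E.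
  rewrite measure_disjoint_union //.
  rewrite (eq_bigr (fun=> (fine (P (ranking 1%g)))%:E)); last first.
    move=> sigma _; rewrite -(rankings_equiprobable sigma) fineK //.
    exact: fin_num_measure.
  by rewrite sumEFin sumr_const mulr_natl.
set U := \bigcup_sigma ranking sigma.
have mU : measurable U.
  apply: fin_bigcup_measurable => [|sigma _]; last exact: measurable_ranking.
  exact: finite_finset.
have measure_on_U A : measurable A -> P A = P (A `&` U).
  move=> mA; rewrite -[in LHS](setUIDK A U).
  have mAU : measurable (A `\` U) by exact: measurableD.
  rewrite measureU0 //; first exact: measurableI.
  apply: measure_negligible => //.
  by apply: negligibleS rankings_exhaust => w [].
have tot : #|{perm I}|%:R * fine (P (ranking 1%g)) = 1.
  apply: EFin_inj; rewrite -unionE -(probability_setT P).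
  rewrite [RHS]measure_on_U // setTI.
  by congr (P _); apply/seteqP; split=> w [sigma _ r]; exists sigma.
rewrite measure_on_U; last exact: measurable_rank_event.
have -> : [set w | E (rank_in (scores V w))] `&` U =
    \bigcup_(sigma in [set` D]) ranking sigma.
  apply/seteqP; split=> w /=.
    by move=> [Ew [sigma _ rw]]; exists sigma => //; apply/asboolP; rewrite -rw.
  by move=> [sigma /asboolP Es rw]; split; [rewrite rw|exists sigma].
rewrite unionE; congr (_%:E); congr (_ * _).
have perm_neq0 : #|{perm I}|%:R != 0 :> R.
  apply/eqP => p0; move: tot; rewrite p0 mul0r => /esym/eqP.
  by rewrite oner_eq0.
by apply: (mulfI perm_neq0); rewrite tot divff.
Qed.
End rank_law.

(** * The critical value *)

Lemma cdfE d (S : measurableType d) (R : realType) (P : probability S R)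
    (X : {RV P >-> R}) t : cdf X t = P [set w | X w <= t].
Proof.
by congr (P _); apply/seteqP; split=> w /=; rewrite in_itv.
Qed.

(** The set of admissible [t] is nonempty since the distribution function
    tends to 1, and by right-continuity its infimum belongs to it. *)
Lemma quantile_exceedance d (S : measurableType d) (R : realType)
    (P : probability S R) (f : S -> R) (mf : measurable_fun setT f)
    (alpha : R) :
  0 < alpha ->
  (P [set w | (inf [set t : R | 0 <= t /\
      ((1 - alpha)%:E <= P [set w | (f w <= t)%R])%E] < f w)%R] <= alpha%:E)%E.
Proof.
move=> alpha_gt0.
pose X : {RV P >-> R} := HB.pack_for {RV P >-> R} f
  (isMeasurableFun.Build _ _ _ _ f mf).
set A := [set t : R | _]; set q := inf A.
have A_n0 : A !=set0.
  apply: contrapT => /set0P/negP; rewrite negbK => /eqP A0.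
  suff : (1 <= (1 - alpha)%:E :> \bar R)%E.
    by rewrite lee_fin lerBrDr gerDl leNgt alpha_gt0.
  apply: (cvge_le _ (cvg_cdfy1 X)); near=> t.
  apply/ltW; rewrite ltNge; apply/negP; rewrite cdfE => At.
  suff : A t by rewrite A0.
  by split=> //; near: t; exact: nbhs_pinfty_ge.
suff : ((1 - alpha)%:E <= P [set w | (X w <= q)%R])%E.
  have mq : measurable [set w | X w <= q].
    rewrite -[X in measurable X]setTI; exact: measurable_fun_le.
  have -> : [set w | q < f w] = ~` [set w | X w <= q].
    by apply/seteqP; split=> w /=; rewrite ltNge => /negP.
  rewrite probability_setC // => h.
  by rewrite leeBlDr ?fin_num_measure // addeC -leeBlDr // -EFinB.
rewrite -cdfE; apply: (cvge_ge _ (@cdf_right_continuous _ _ _ _ X q)).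
near=> t.
have [u Au ut] : exists2 u, A u & u < t.
  by apply: inf_lt => //; near: t; exact: nbhs_right_gt.
apply: (le_trans Au.2); change (P [set w | (X w <= u)%R] <= cdf X t)%E.
by rewrite -cdfE; apply: cdf_nondecreasing; exact: ltW.
Unshelve. all: by end_near. Qed.

(** * The two-stage test *)

Definition stat_of_ranks (R : realType) (phi : R -> R) (a b : nat)
    (r : 'I_a + 'I_b -> nat) : R :=
  \sum_(i < a) phi ((r (inl i))%:R / (a + b + 1)%:R).

Lemma rank_stat_ranks (R : realType) (phi : R -> R) disp (T : orderType disp)
    (a b : nat) (x : a.-tuple T) (y : b.-tuple T) :
  rank_stat phi x y = stat_of_ranks phi (rank_in (pooled (tnth x) (tnth y))).
Proof.
by apply: eq_bigr => i _; rewrite /rank_in /rank big_sumType.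
Qed.

Definition rejected (R : realType) (phi : R -> R) (q : R) (a b : nat) :
    set ('I_a + 'I_b -> nat) :=
  [set r | phi_mean phi + q < stat_of_ranks phi r / a%:R].

(** The univariate null model is the case of an empty training sample, its
    observations being their own scores. *)
Lemma null_rejection_frequency (R : realType) (a b : nat)
    (M : null_model R a b) (phi : R -> R) (alpha : R) :
  0 < alpha ->
  #|[pred sigma : {perm 'I_a + 'I_b} |
      `[< rejected phi (null_quantile M phi alpha) (perm_rank sigma) >]]|%:R
    / #|{perm 'I_a + 'I_b}|%:R <= alpha.
Proof.
move=> alpha_gt0.
pose g (k : 'I_0 + ('I_a + 'I_b)) : 'I_a + 'I_b :=
  match k with inl i => False_rect _ (notF (ltn_ord i)) | inr i => i end.
have g_inj : injective g by move=> [[]//|i] [[]//|j] /= ->.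
pose V := null_obs M \o g.
have VF := iid_reindex g_inj (null_obs_iid M).
pose s (_ : 0.-tuple R) (x : R) := x%:E.
have ms : measurable_fun setT (fun p : 0.-tuple R * R => s p.1 p.2).
  exact: measurableT_comp.
have F_cont u : continuous_law (pushforward (null_law M) (s u)).
  move=> t; case: t => [x| |].
  - rewrite -[RHS](null_law_continuous M x) /pushforward; congr (_ _).
    by apply/seteqP; split=> y /=; [case|move=> ->].
  - by rewrite /pushforward (_ : _ @^-1` _ = set0) // ; apply/seteqP; split.
  - by rewrite /pushforward (_ : _ @^-1` _ = set0) // ; apply/seteqP; split.
have statE w : null_rank_stat phi w =
    stat_of_ranks phi (rank_in (scores s V w)).
  rewrite /null_rank_stat rank_stat_ranks; congr stat_of_ranks.
  apply/funext => i; apply: eq_bigr => k _; rewrite /scores /s /= lee_fin.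
  by case: i => i; case: k => k; rewrite /= !tnth_mktuple.
have mstat : measurable_fun setT
    (fun w : null_space M => null_rank_stat phi w / a%:R - phi_mean phi).
  move=> _ B mB; rewrite setTI.
  have := measurable_rank_event ms V
    [set r | B (stat_of_ranks phi r / a%:R - phi_mean phi)].
  by congr (measurable _); apply/funext => w /=; rewrite statE.
rewrite -lee_fin -(rank_event_prob ms VF F_cont).
apply: le_trans (quantile_exceedance (null_prob M) mstat alpha_gt0).
rewrite le_eqVlt; apply/orP; left; apply/eqP; congr (null_prob M _).
by apply/funext => w /=; rewrite /rejected /= statE ltrBrDl.
Qed.

(** Relabels the pooled data: training observations first, then the test
    observations, which come last within each of the two samples. *)
Definition obs_index (n m n2 m2 : nat) (len : (n2 <= n)%N) (lem : (m2 <= m)%N)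
    (k : 'I_((n - n2) + (m - m2)) + ('I_n2 + 'I_m2)) : 'I_n + 'I_m :=
  match k with
  | inl k => match fintype.split k with
             | inl i => inl (cast_ord (subnK len) (lshift n2 i))
             | inr j => inr (cast_ord (subnK lem) (lshift m2 j))
             end
  | inr (inl i) => inl (cast_ord (subnK len) (rshift (n - n2) i))
  | inr (inr j) => inr (cast_ord (subnK lem) (rshift (m - m2) j))
  end.

Lemma obs_index_inj (n m n2 m2 : nat) (len : (n2 <= n)%N) (lem : (m2 <= m)%N) :
  injective (@obs_index n m n2 m2 len lem).
Proof.
move=> [k|[i|j]] [k'|[i'|j']]; rewrite /obs_index;
  try case: (split_ordP k) => ? ->; try case: (split_ordP k') => ? ->;
  move=> //.
all: try move=> /(@inl_inj _ _ _ _) /cast_ord_inj /eqP.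
all: try move=> /(@inr_inj _ _ _ _) /cast_ord_inj /eqP.
all: by rewrite ?eq_lshift ?eq_rshift ?eq_lrshift ?eq_rlshift // => /eqP ->.
Qed.

Theorem theorem3 (R : realType)
    (phi : R -> R) (phi_score : score_generating phi)
    (n m : nat) (n_ge2 : (2 <= n)%N) (m_ge2 : (2 <= m)%N)
    (alpha : R) (alpha_gt0 : 0 < alpha) (alpha_lt1 : alpha < 1)
    (n2 m2 : nat) (n2_gt0 : (1 <= n2)%N) (n2_lt : (n2 < n)%N)
    (m2_gt0 : (1 <= m2)%N) (m2_lt : (m2 < m)%N)
    (k : nat) (dZ : measure_display) (Z : measurableType dZ)
    (iota : Z -> k.-tuple R) (Z_sub : euclidean_subspace iota)
    (dO : measure_display) (Omega : measurableType dO)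
    (P : probability Omega R) (G H : probability Z R)
    (X : 'I_n -> {RV P >-> Z}) (Y : 'I_m -> {RV P >-> Z})
    (X_iid : iid X G) (Y_iid : iid Y H) (XY_indep : independent_samples X Y)
    (S0 : set (Z -> \bar R))
    (S0_scoring : forall s, S0 s -> scoring_function s)
    (S0_continuous : forall s, S0 s ->
       (forall i, continuous_law (pushforward P (s \o X i))) /\
       (forall j, continuous_law (pushforward P (s \o Y j))))
    (learn : (n - n2).-tuple Z * (m - m2).-tuple Z -> Z -> \bar R)
    (learnP : learning_rule phi S0 learn)
    (M : null_model R n2 m2)
    (H0 : forall A : set Z, measurable A -> G A = H A) :
  (P [set w | two_stage_test phi (null_quantile M phi alpha)
                (ltnW n2_lt) (ltnW m2_lt) learn (sample X w) (sample Y w)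
              = 1%N]
   <= alpha%:E)%E.
Proof.
case: learnP => learn_S0 _ learn_meas.
have Y_iidG : iid Y G.
  by split=> [|j A mA]; [exact: Y_iid.1|rewrite Y_iid.2 // H0].
pose l := ((n - n2) + (m - m2))%N.
pose I : finType := ('I_n2 + 'I_m2)%type.
pose g := @obs_index n m n2 m2 (ltnW n2_lt) (ltnW m2_lt).
have g_inj : injective g by exact: obs_index_inj.
pose V := pooled X Y \o g.
have VG : iid V G := iid_reindex g_inj (iid_pooled X_iid Y_iidG XY_indep).
pose train (t : l.-tuple Z) := ([tuple tnth t (lshift (m - m2) i) | i < n - n2],
  [tuple tnth t (rshift (n - n2) j) | j < m - m2]).
pose s t := learn (train t).
have mtrain : measurable_fun setT train.
  apply: measurable_fun_pair; apply/measurable_fun_tnthP => i.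
    rewrite (_ : _ \o _ = (fun t => tnth t (lshift (m - m2) i))).
      exact: measurable_tnth.
    by apply/funext => t; rewrite /= tnth_mktuple.
  rewrite (_ : _ \o _ = (fun t => tnth t (rshift (n - n2) i))).
    exact: measurable_tnth.
  by apply/funext => t; rewrite /= tnth_mktuple.
have ms : measurable_fun setT (fun p : l.-tuple Z * Z => s p.1 p.2).
  apply: (measurableT_comp learn_meas
    (g := fun p : l.-tuple Z * Z => (train p.1, p.2))).
  by apply: measurable_fun_pair => //; exact: measurableT_comp.
have G_cont t : continuous_law (pushforward G (s t)).
  move=> y; have [sm _] := S0_scoring _ (learn_S0 (train t)).
  pose i0 : 'I_n := Ordinal (ltn_trans n2_gt0 n2_lt).
  have [/(_ i0 y) <- _] := S0_continuous _ (learn_S0 (train t)).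
  have [_ X_law] := X_iid; rewrite /pushforward -(X_law i0) //.
  rewrite -[X in measurable X]setTI; apply: sm => //.
have := null_rejection_frequency M phi alpha_gt0.
rewrite -lee_fin -(rank_event_prob ms VG G_cont) => /(le_trans _); apply.
rewrite le_eqVlt; apply/orP; left; apply/eqP; congr (P _).
apply/funext => w /=.
have trainE : train (sample (V \o inl) w) =
    (first_part (ltnW n2_lt) (sample X w),
     first_part (ltnW m2_lt) (sample Y w)).
  congr (_, _); apply: eq_from_tnth => i;
    rewrite !tnth_mktuple /= /V /= /g /obs_index.
    by rewrite (unsplitK (inl i)).
  by rewrite (unsplitK (inr i)).
rewrite /two_stage_test /rank_test -trainE rank_stat_ranks.
rewrite (_ : pooled _ _ = scores s V w); last first.
  by apply/funext => -[i|j]; rewrite /scores /= tnth_map !tnth_mktuple.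
rewrite /rejected /=; apply/propext; split; last by move=> ->.
by case: (_ < _).
Qed.
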